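(* Let $B\subset[\mathbb{N}]^{\mathbb{N}}$ be a Borel set. There exist a closed set $C\subset[\mathbb{N}]^{\mathbb{N}}$ and a continuous, shift-invariant injection $\Psi:C\to B$ such that $\Psi^{-1}$ (defined on $\Psi(C)$) is also shift-invariant and $\chi_B(\mathcal{G}_{\mathcal{S}}|_C)=\chi_B(\mathcal{G}_{\mathcal{S}}|_B)$. If $B$ is closed under the shift map $\mathcal{S}$, then $\Psi$ can be taken to be a bijection from $C$ onto $B$.
   Context: $[\mathbb{N}]^{\mathbb{N}}$ is the set of infinite subsets of $\mathbb{N}$, each identified with its increasing enumeration, with the topology inherited from $\mathbb{N}^{\mathbb{N}}$. The shift map is $\mathcal{S}(x)=x\setminus\{\min x\}$. The shift graph is $\mathcal{G}_{\mathcal{S}}=([\mathbb{N}]^{\mathbb{N}},E_{\mathcal{S}})$ where $xE_{\mathcal{S}}y\iff x\ne y$ and ($\mathcal{S}(x)=y$ or $\mathcal{S}(y)=x$). For a graph $\mathcal{G}=(X,E)$ and $B\subset X$, $\mathcal{G}|_B=(X,E\cap B^2)$. The Borel chromatic number $\chi_B$ of a Borel graph $(X,E)$ ($X$ Polish, $E$ a symmetric irreflexive Borel relation) is the minimal $n\in\{1,2,\dots,\aleph_0\}$ such that there are a Polish space $Y$ and a Borel map $c:X\to Y$ whose image has size $n$ and with $xEy\Rightarrow c(x)\neq c(y)$ (uncountable if no such $n$ exists). A map $g$ from a set $D\subset[\mathbb{N}]^{\mathbb{N}}$ to $[\mathbb{N}]^{\mathbb{N}}$ is shift-invariant if it commutes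 with the shift: $g(\mathcal{S}(x))=\mathcal{S}(g(x))$ whenever $x,\mathcal{S}(x)\in D$. A set $B$ is closed under the shift map if $\mathcal{S}(x)\in B$ for all $x\in B$. *)

(* Defs.v *)
From HB Require Import structures.
From mathcomp Require Import all_boot all_order all_algebra.
From mathcomp Require Import all_classical all_reals all_analysis.

Set Implicit Arguments.
Unset Strict Implicit.
Unset Printing Implicit Defensive.

Local Open Scope classical_set_scope.
Local Open Scope card_scope.

(* An infinite subset of nat is represented by its increasing enumeration;
   [range_infN] and [range_shift] below relate this to sets of naturals. *)
Definition increasing : set {ptws nat -> nat} :=
  [set x | forall n, (x n < x n.+1)%N].

Definition infN : Type := set_type increasing.

HB.instance Definition _ := Topological.on infN.

Definition enum_of (x : infN) : nat -> nat := set_val x.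

Lemma enum_of_lt (x : infN) n : (enum_of x n < enum_of x n.+1)%N.
Proof. by case: x => u up; exact: (set_mem up n). Qed.

Lemma enum_of_mono (x : infN) : {mono enum_of x : m n / (m <= n)%N}.
Proof.
by apply: leq_mono; apply: homo_ltn; [exact: ltn_trans | exact: enum_of_lt].
Qed.

Lemma enum_of_inj (x : infN) : injective (enum_of x).
Proof. exact/incn_inj/enum_of_mono. Qed.

Lemma increasing_shift (x : infN) :
  (fun n => enum_of x n.+1) \in increasing.
Proof. by apply/mem_set => n; exact: enum_of_lt. Qed.

Definition shift (x : infN) : infN := SigSub (increasing_shift x).

Lemma infinite_next (A : set nat) : infinite_set A ->
  forall n, exists m, (n <= m)%N && `[< A m >].
Proof.
move=> Ainf n; apply: contra_notP Ainf => /forallNP H.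
apply: (sub_finite_set _ (finite_II n)) => m Am /=.
rewrite ltnNge; apply/negP => nm; apply: (H m).
by rewrite nm; apply/asboolP.
Qed.

Lemma range_infN : set_bij setT [set A : set nat | infinite_set A]
  (fun x => range (enum_of x)).
Proof.
split.
- move=> x _ /=; rewrite (eq_finite_set (inj_card_eq _)); first exact: infinite_nat.
  by move=> m n _ _; exact: enum_of_inj.
- move=> x y _ _ /= xy; apply/val_inj/funext => n.
  have sub (u v : infN) m : range (enum_of u) = range (enum_of v) ->
      (forall k, (k < m)%N -> enum_of u k = enum_of v k) ->
      (enum_of v m <= enum_of u m)%N.
    move=> uv IH; have [k _ kE] : range (enum_of v) (enum_of u m).
      by rewrite -uv; exists m.
    rewrite -kE (enum_of_mono v) leqNgt; apply/negP => km.
    by have /enum_of_inj km' := etrans (IH _ km) kE; rewrite km' ltnn in km.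
  elim/ltn_ind: n => n IH; apply/eqP; rewrite eqn_leq; apply/andP; split.
    by apply: sub => // k /IH.
  exact: sub.
- move=> A /= Ainf; pose nxt n := ex_minn (infinite_next Ainf n).
  pose fix u n := if n is k.+1 then nxt (u k).+1 else nxt 0.
  have ult n : (u n < u n.+1)%N.
    by rewrite /= /nxt; case: ex_minnP => m /andP[].
  have uA n : A (u n).
    by case: n => [|n]; rewrite /= /nxt; case: ex_minnP => m /andP[_ /asboolP].
  have ule n : (n <= u n)%N by elim: n => // n IH; exact: leq_ltn_trans (ult n).
  exists (SigSub (mem_set (ult : increasing u))) => //; apply/seteqP; split.
    by move=> _ [n _ <-]; exact: uA.
  move=> a Aa; have aP : exists k, (a <= u k)%N by exists a.
  case: (ex_minnP aP) => k auk kmin; exists k => //.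
  apply/eqP; rewrite eqn_leq auk andbT.
  have nxtP n : (n <= a)%N -> (nxt n <= a)%N.
    rewrite /nxt; case: ex_minnP => m _ mmin na.
    by apply: mmin; rewrite na; exact/asboolP.
  case: k auk kmin => [|k] _ kmin; first exact: (nxtP 0).
  by apply: (nxtP (u k).+1); rewrite ltnNge; apply/negP => /kmin; rewrite ltnn.
Qed.

Lemma range_shift (x : infN) :
  range (enum_of (shift x)) = range (enum_of x) `\ enum_of x 0.
Proof.
apply/seteqP; split => [_ [n _ <-]|_ [[n _ <-] /= ne]].
  by split; [exists n.+1 | move=> /= e; have := @enum_of_inj x _ _ e].
by case: n ne => [/(_ erefl)|n _] //; exists n.
Qed.

(* [shift_invariant D g]: [g] is only considered on [D]. *)
Definition shift_invariant (D : set infN) (g : infN -> infN) : Prop :=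
  forall x, D x -> D (shift x) -> g (shift x) = shift (g x).

Definition shift_closed (B : set infN) : Prop := forall x, B x -> B (shift x).

Definition shift_graph (x y : infN) : Prop :=
  x <> y /\ (shift x = y \/ shift y = x).

Definition graph_restr (T : Type) (E : T -> T -> Prop) (B : set T) :
  T -> T -> Prop := fun x y => [/\ E x y, B x & B y].

Definition borel (T : topologicalType) : set_system T := <<s open >>.

Definition borel_map (T U : topologicalType) (f : T -> U) : Prop :=
  forall A : set U, borel A -> borel (f @^-1` A).

(* [R] only serves as the codomain of the metrics. *)
Definition polish (R : realType) (Y : metricType R) : Prop :=
  (exists2 D : set Y, countable D & dense D) /\
  (forall F : set_system Y, ProperFilter F -> cauchy F -> exists y : Y, F --> y).

Definition proper_coloring (T Y : Type) (E : T -> T -> Prop) (c : T -> Y) :=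
  forall x y, E x y -> c x <> c y.

(* The size of the image is given by a set of that cardinality: [`I_n] for a
   finite size [n], [[set: nat]] for aleph_0. *)
Definition borel_colorable (R : realType) (T : topologicalType)
    (E : T -> T -> Prop) (size : set nat) : Prop :=
  exists (Y : metricType R) (c : T -> Y),
    [/\ polish Y, borel_map c, range c #= size & proper_coloring E c].

Inductive chromatic_number : Type := Finite of nat | Aleph0 | Uncountable.

Definition borel_chi (R : realType) (T : topologicalType)
    (E : T -> T -> Prop) : chromatic_number :=
  match pselect (exists n, (0 < n)%N && `[< borel_colorable R E `I_n >]) with
  | left ex => Finite (ex_minn ex)
  | right _ =>
      if `[< borel_colorable R E [set: nat] >] then Aleph0 else Uncountable
  end.

Definition shift_embedding (C B : set infN) (Psi : infN -> infN) : Prop :=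
  [/\ {within C, continuous Psi},
      set_fun C B Psi,
      set_inj C Psi,
      shift_invariant C Psi &
      shift_invariant (Psi @` C) ('pinv_(id) C Psi)].

(* Main.v *)
Require Import Defs.
From mathcomp Require Import all_boot all_order all_algebra.
From mathcomp Require Import all_classical all_reals all_analysis.

Set Implicit Arguments.
Unset Strict Implicit.
Unset Printing Implicit Defensive.

Local Open Scope classical_set_scope.

(* Every Borel set B has a witness: an operator w with closed graph, Borel as a
   function of x, such that the value w x 0 decides whether x is in B.  Recode
   x as the sequence of the h (S^n x), where h z codes min z together with the
   first digits of w (s ++ z) for all the s included in [0, min z).  Each tail
   thus also carries information on its finitely many possible completions, so
   that the codes of the tails of x disclose all of w x; since w has a closed
   graph, the recodings of the points of B form a closed set.  The data coded at
   z is contained in the data coded at S z, which leaves room to choose h with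
   h z < h (S z), so that the recoding of x is again an increasing sequence.
   The recoding Phi is injective, commutes with S on the whole space, is Borel,
   and has a continuous left inverse Psi, with which the theorem holds for
   C = Phi(B) even when B is not closed under the shift. *)

(* [shift] alone would denote the translation of a normed module. *)
Local Notation shift := Defs.shift.

(** * Topology and Borel structure *)

Definition agree (n : nat) (u v : nat -> nat) : Prop :=
  forall i, (i < n)%N -> u i = v i.

Lemma coord_nbhs (x : infN) (n : nat) :
  nbhs x [set y | enum_of y n = enum_of x n].
Proof.
have pr : nbhs (set_val x : {ptws nat -> nat}) [set f | f n = enum_of x n].
  exact: (@proj_continuous nat (fun=> nat) n (set_val x) _ (discrete_set1 _)).
exact: (@initial_continuous _ _ (set_val : infN -> {ptws nat -> nat}) x _ pr).
Qed.

Lemma cylinder_nbhs (x : infN) (n : nat) :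
  nbhs x [set y | agree n (enum_of y) (enum_of x)].
Proof.
elim: n => [|n IH]; first by apply: filterS filterT => y _.
apply: filterS (filterI IH (coord_nbhs x n)) => y [H1 H2] i.
by rewrite ltnS leq_eqVlt => /predU1P[->//|/H1].
Qed.

Lemma nbhs_cylinder (x : infN) (A : set infN) : nbhs x A ->
  exists n, forall y, agree n (enum_of y) (enum_of x) -> A y.
Proof.
rewrite nbhsE => -[_ [[V oV <-] Vx] VA].
(* The filter generated by the cylinders around [x] converges in each coordinate, hence for the
   product topology, so [V] contains a cylinder. *)
pose cyl : set_system {ptws nat -> nat} := [set W | exists n, forall f,
  agree n f (enum_of x) -> W f].
have cylF : Filter cyl.
  split; first by exists 0%N.
    move=> P Q [n nP] [m mQ]; exists (maxn n m) => f fx; split.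
      by apply: nP => i lin; apply: fx; rewrite leq_max lin.
    by apply: mQ => i lim; apply: fx; rewrite leq_max lim orbT.
  by move=> P Q PQ [n nP]; exists n => f /nP /PQ.
have /(_ V) : cyl --> (set_val x : {ptws nat -> nat}).
  apply/cvg_sup => n W [_ [[D oD <-] Dx] DW]; exists n.+1 => f fx.
  by apply: DW => /=; rewrite fx.
case; first exact: open_nbhs_nbhs.
by move=> n nV; exists n => y yx; apply: VA; apply: nV.
Qed.

Section BorelFunctions.
Variable X : topologicalType.

Lemma borelC (A : set X) : borel A -> borel (~` A).
Proof. by rewrite -setTD; exact: sigma_algebraCD. Qed.

Lemma borel_bigcup (I : countType) (F : I -> set X) :
  (forall i, borel (F i)) -> borel (\bigcup_i F i).
Proof.
move=> Fb; pose G n := if unpickle n is Some i then F i else set0.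
have -> : \bigcup_i F i = \bigcup_n G n.
  apply/seteqP; split=> x [i _]; last first.
    by rewrite /G; case: unpickle => // j Fx; exists j.
  by move=> Fx; exists (pickle i) => //; rewrite /G pickleK.
apply: sigma_algebra_bigcup => n; rewrite /G; case: unpickle => //.
exact: sigma_algebra0.
Qed.

Lemma borelI (A A' : set X) : borel A -> borel A' -> borel (A `&` A').
Proof.
move=> bA bA'; rewrite -[_ `&` _]setCK setCI.
have -> : ~` A `|` ~` A' = \bigcup_(b : bool) (if b then ~` A else ~` A').
  apply/seteqP; split=> x /=; first by case=> ?; [exists true | exists false].
  by case; case=> _ ?; [left | right].
by apply: borelC; apply: borel_bigcup => -[]; exact: borelC.
Qed.

Lemma borel_map_open (Y : topologicalType) (f : X -> Y) :
  (forall U, open U -> borel (f @^-1` U)) -> borel_map f.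
Proof.
move=> fo; suff : @borel Y `<=` [set B : set Y | borel (f @^-1` B)] by apply.
apply: smallest_sub => [|U oU]; last exact: fo.
split=> [|B Bb|F Fb] /=.
- by rewrite preimage_set0; exact: sigma_algebra0.
- by rewrite setTD preimage_setC; exact: borelC.
- by rewrite preimage_bigcup; exact: borel_bigcup.
Qed.

(** [T] is treated as a discrete space, so all its subsets are tested. *)
Definition borel_fun (T : countType) (f : X -> T) : Prop :=
  forall A : set T, borel (f @^-1` A).

Lemma borel_fun_fiber (T : countType) (f : X -> T) :
  (forall t, borel (f @^-1` [set t])) -> borel_fun f.
Proof.
move=> ft A.
have -> : f @^-1` A =
    \bigcup_t (f @^-1` [set t] `&` (if `[<A t>] then setT else set0)).
  apply/seteqP; split=> [x Ax | x [t _ [/= <-]]]; last by case: asboolP.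
  by exists (f x) => //; split=> //=; case: asboolP.
apply: borel_bigcup => t; case: ifP => _; first by rewrite setIT.
by rewrite setI0; exact: sigma_algebra0.
Qed.

Lemma borel_fun_cst (T : countType) (t : T) : borel_fun (fun=> t).
Proof.
move=> A; rewrite preimage_cst; case: ifP => _; last exact: sigma_algebra0.
by rewrite -setC0; apply: borelC; exact: sigma_algebra0.
Qed.

Lemma borel_fun_comp (S T : countType) (k : S -> T) (f : X -> S) :
  borel_fun f -> borel_fun (k \o f).
Proof. by move=> bf A; exact: (bf (k @^-1` A)). Qed.

Lemma borel_fun_bind (S T : countType) (f : X -> S) (g : S -> X -> T) :
  borel_fun f -> (forall s, borel_fun (g s)) -> borel_fun (fun x => g (f x) x).
Proof.
move=> bf bg A.
have -> : (fun x => g (f x) x) @^-1` A =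
    \bigcup_s (f @^-1` [set s] `&` g s @^-1` A).
  by apply/seteqP; split=> [x Ax | x [s _ [/= <-]]] //; exists (f x).
by apply: borel_bigcup => s; apply: borelI; [exact: bf | exact: bg].
Qed.

Lemma borel_fun_map (I : Type) (T : countType) (g : I -> X -> T) (s : seq I) :
  (forall i, borel_fun (g i)) -> borel_fun (fun x => [seq g i x | i <- s]).
Proof.
move=> bg; elim: s => [|i s IH] /=; first exact: borel_fun_cst.
apply: (borel_fun_bind (g := fun t x => t :: [seq g j x | j <- s]) (bg i)) => t.
exact: (borel_fun_comp (cons t) IH).
Qed.

End BorelFunctions.

(** The value 0 is reserved for a [P] that is never true, so that a nonzero value certifies
    success. *)
Definition first_true (P : nat -> bool) : nat :=
  if pselect (exists n, P n) is left ex then (ex_minn ex).+1 else 0%N.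

Lemma first_true0P (P : nat -> bool) :
  first_true P = 0%N <-> forall k, ~~ P k.
Proof.
rewrite /first_true; case: pselect => [ex|nex].
  by split=> // H; case: ex => n Pn; move: (H n); rewrite Pn.
by split=> // _ k; apply/negP => Pk; apply: nex; exists k.
Qed.

Lemma first_trueSP (P : nat -> bool) (k : nat) :
  first_true P = k.+1 <-> P k /\ forall j, (j < k)%N -> ~~ P j.
Proof.
rewrite /first_true; case: pselect => [ex|nex]; last first.
  by split=> // -[Pk _]; case: nex; exists k.
case: ex_minnP => m Pm minm; split=> [[<-]|[Pk kmin]].
  by split=> // j jm; apply/negP => /minm; rewrite leqNgt jm.
congr _.+1; apply/eqP; rewrite eqn_leq minm //= leqNgt; apply/negP => mk.
by move: (kmin _ mk); rewrite Pm.
Qed.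

(** A nonzero value depends on finitely many terms of [P]; the value 0 concerns all terms, but each
    of them is seen by some approximation. *)
Lemma first_true_limit (P : nat -> bool) (c : nat) :
  (forall n, exists2 Q : nat -> bool,
     (forall k, (k < n)%N -> Q k = P k) & first_true Q = c) ->
  first_true P = c.
Proof.
case: c => [|c] H.
  apply/first_true0P => k; have [Q QP /first_true0P Q0] := H k.+1.
  by rewrite -QP.
have [Q QP /first_trueSP[Qc Qm]] := H c.+1.
apply/first_trueSP; split=> [|j jc]; first by rewrite -QP.
by rewrite -QP ?Qm // ltnW.
Qed.

Lemma borel_first_true (X : topologicalType) (P : nat -> X -> bool) :
  (forall k, borel_fun (P k)) -> borel_fun (fun x => first_true (P^~ x)).
Proof.
move=> bP.
have bS k : borel [set x | first_true (P^~ x) = k.+1].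
  (* The first [k.+1] values decide this event: [find] returns [k] exactly when only the last of
     them is true. *)
  have -> : [set x | first_true (P^~ x) = k.+1] =
      (fun x => [seq P i x | i <- iota 0 k.+1]) @^-1` [set s | find id s = k].
    apply/seteqP; split=> x.
      rewrite /preimage /mkset => /first_trueSP[Pk Pj].
      rewrite -[k.+1]addn1 iotaD map_cat find_cat.
      rewrite /= add0n Pk addn0 size_map size_iota.
      case: ifP => // /hasP[b /mapP[j]]; rewrite mem_iota => /Pj Pj0 ->.
      by rewrite (negbTE Pj0).
    rewrite /preimage /mkset -/(mkseq _ _) => fk.
    have hs : has id (mkseq (P^~ x) k.+1) by rewrite has_find fk size_mkseq.
    apply/first_trueSP; split.
      by have := nth_find false hs; rewrite fk nth_mkseq.
    move=> j jk; have := @before_find _ false id (mkseq (P^~ x) k.+1) j.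
    by rewrite fk => /(_ jk); rewrite nth_mkseq ?(ltn_trans jk) // => ->.
  exact: borel_fun_map.
apply: borel_fun_fiber => -[|k]; last exact: bS.
have -> : (fun x => first_true (P^~ x)) @^-1` [set 0%N] =
    ~` \bigcup_k [set x | first_true (P^~ x) = k.+1].
  apply/seteqP; split=> x /=; first by move=> x0 [k _ /=]; rewrite x0.
  by case e: first_true => [|k] // []; exists k.
by apply: borelC; exact: borel_bigcup.
Qed.

(** * Witnesses with closed graph *)

(** The hypothesis places [(u, v)] in the closure of the graph. [w] acts on all sequences, so it
    applies to [prepend s u] without a proof that this is increasing. *)
Definition closed_graph (w : (nat -> nat) -> nat -> nat) : Prop :=
  forall u v, (forall n, exists2 u', agree n u' u & agree n (w u') v) ->
  w u = v.

(** Ranging over all Borel families [g] allows [w] to be composed with prefixes, tails and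
    coordinatewise Borel maps. *)
Definition borel_operator (w : (nat -> nat) -> nat -> nat) : Prop :=
  forall g : infN -> nat -> nat, (forall n, borel_fun (g^~ n)) ->
  forall i, borel_fun (fun x => w (g x) i).

(** The pairs [(x, w x)] with [w x 0 != 0] form a closed set projecting injectively onto [B], as
    when a Borel set is presented as an injective continuous image of a closed set. *)
Definition witness (B : set infN) (w : (nat -> nat) -> nat -> nat) : Prop :=
  [/\ closed_graph w, borel_operator w &
      forall x, B x <-> w (enum_of x) 0%N != 0%N].

Lemma agreeW m n u v : (m <= n)%N -> agree n u v -> agree m u v.
Proof. by move=> mn uv i im; apply: uv; exact: leq_trans mn. Qed.

Lemma open_witness (U : set infN) : open U -> exists w, witness U w.
Proof.
move=> oU.
(* [P u k] depends only on the first [k] values of [u]. It may hold vacuously when these are not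
   increasing, which is harmless: membership is only read at enumerations. *)
pose P (u : nat -> nat) k := `[< forall x, agree k (enum_of x) u -> U x >].
have Pagree k u u' : agree k u u' -> P u k = P u' k.
  move=> uu'; apply/asbool_equiv_eq; split=> + x xu; apply=> i ik.
    by rewrite xu // uu'.
  by rewrite xu // uu'.
exists (fun u _ => first_true (P u)); split.
- move=> u v H; apply/funext => i; apply: first_true_limit => n.
  have [u' u'u wv] := H (maxn n i.+1); exists (P u').
    by move=> k kn; apply/Pagree/(agreeW _ u'u); rewrite leq_max ltnW.
  by apply: wv; rewrite leq_max ltnSn orbT.
- move=> g gb _; apply: borel_first_true => k.
  have -> : (fun x => P (g x) k) =
      (fun s => P (nth 0%N s) k) \o (fun x => mkseq (g x) k).
    apply/funext => x /=; apply: Pagree => i ik.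
    by rewrite nth_mkseq.
  by apply: borel_fun_comp; apply: borel_fun_map.
- move=> x; split=> [Ux|].
    apply/eqP => /first_true0P Pn.
    have [n nU] := nbhs_cylinder (open_nbhs_nbhs (conj oU Ux)).
    by move: (Pn n); rewrite /P asboolT.
  case e: first_true => [|k] // _.
  by move/first_trueSP: e => [/asboolP + _]; apply.
Qed.

(** The negated bit alone need not have a closed graph, so the old values are kept, moved one place
    up; in the limit they determine the bit. *)
Lemma witnessC (B : set infN) w : witness B w -> exists w', witness (~` B) w'.
Proof.
move=> [wc wb wB].
exists (fun u i => if i is j.+1 then w u j else (w u 0%N == 0%N) : nat); split.
- move=> u v H; have wE : w u = (fun j => v j.+1).
    apply: wc => n; have [u' u'u wv] := H n.+1.
    by exists u'; [exact: agreeW u'u | move=> i /= ilt; exact: (wv i.+1)].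
  apply/funext => -[|i]; last by rewrite wE.
  have [u' u'u wv] := H 2%N.
  by rewrite wE -(wv 1%N) // -(wv 0%N).
- move=> g gb [|i]; last exact: wb.
  exact: (borel_fun_comp (fun m => (m == 0%N) : nat) (wb _ gb 0%N)).
- move=> x; have [BwI wBI] := wB x.
  split=> [nBx|w0 /BwI]; last by move: w0; case: (w _ 0%N).
  by case: (w _ 0%N) wBI => // m /(_ isT).
Qed.

(* The value at 0 records the least [i] with [F i x]: with a mere bit, the graph
   would not be closed, as membership in the union may be lost in the limit. *)
Lemma witness_bigcup (F : nat -> set infN) :
  (forall i, exists w, witness (F i) w) -> exists w, witness (\bigcup_i F i) w.
Proof.
move=> /choice[w Fw].
exists (fun u n => if n is m.+1 then
    if pickle_inv m is Some p then w p.1 u p.2 else 0%N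
  else first_true (fun i => w i u 0%N != 0%N)); split.
- move=> u v H.
  have wE i j : w i u j = v (pickle (i, j)).+1.
    have [wc _ _] := Fw i.
    rewrite (_ : w i u = fun j => v (pickle (i, j)).+1) //; apply: wc => n.
    (* Agreement up to [N] covers the places where the first [n] digits of [w i u] are stored. *)
    pose N := (\max_(j < n) (pickle (i, nat_of_ord j)).+2)%N.
    have [u' u'u wv] := H (maxn n N); exists u'.
      by apply: agreeW u'u; rewrite leq_maxl.
    move=> k kn; have := wv (pickle (i, k)).+1.
    rewrite /= pickleK_inv /=; apply.
    rewrite leq_max; apply/orP; right.
    exact: (leq_bigmax (Ordinal kn)).
  apply/funext => -[|m] /=; last first.
    case e: pickle_inv => [[i j]|] /=.
      by have := @pickle_invK (nat * nat)%type m; rewrite /oapp e wE => ->.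
    have [u' _ wv] := H m.+2.
    by have := wv m.+1 (ltnSn _); rewrite /= e => <-.
  apply: first_true_limit => n.
  pose N := (\max_(j < n) (pickle (nat_of_ord j, 0%N)).+2)%N.
  have [u' u'u wv] := H (maxn 1 N).
  exists (fun i => w i u' 0%N != 0%N); last by apply: (wv 0%N); rewrite leq_max.
  move=> k kn; rewrite wE -(wv (pickle (k, 0%N)).+1) /= ?pickleK_inv //.
  rewrite leq_max; apply/orP; right.
  exact: (leq_bigmax (Ordinal kn)).
- move=> g gb [|m].
    apply: borel_first_true => k; have [_ wb _] := Fw k.
    exact: (borel_fun_comp (fun m => m != 0%N) (wb _ gb 0%N)).
  case: pickle_inv => [p|]; last exact: borel_fun_cst.
  by have [_ wb _] := Fw p.1; exact: wb.
- move=> x; split=> [[i _ Fx]|].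
    apply/eqP => /first_true0P /(_ i); have [_ _ /(_ x) FxE] := Fw i.
    by move/negP; apply; apply/FxE.
  case e: first_true => [|k] // _; move/first_trueSP: e => [wk _].
  by exists k => //; have [_ _ H] := Fw k; apply/H.
Qed.

Lemma borel_witness (B : set infN) : borel B -> exists w, witness B w.
Proof.
suff : @borel infN `<=` [set A | exists w, witness A w] by apply.
apply: smallest_sub => [|U]; last exact: open_witness.
split=> [|A [w]|F]; first exact: open_witness open0.
  by rewrite setTD; exact: witnessC.
exact: witness_bigcup.
Qed.

(** * Recoding *)

(** With the length of [d] fixed by [m], only finitely many data share a given value of [K]. Each
    value gets its own block of integers, starting at [S k] and long enough for their pickles:
    blocks give monotonicity, pickles give injectivity. *)
Lemma monotone_code (K : nat -> seq nat -> nat) (L : nat -> nat) :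
  (forall m d, (m <= K m d)%N /\ all (geq (K m d)) d) ->
  exists code : nat -> seq nat -> nat,
    (forall m d m' d', size d = L m -> size d' = L m' ->
      code m d = code m' d' -> m = m' /\ d = d') /\
    (forall m d m' d', size d = L m -> (K m d < K m' d')%N ->
      (code m d < code m' d')%N).
Proof.
move=> Kbound.
pose b k := (\max_(m < k.+1) \max_(d : (L m).-tuple 'I_k.+1)
  pickle (nat_of_ord m, map val d))%N.
pose S k := (\sum_(j < k) (b j).+1)%N.
pose code m d := (S (K m d) + pickle (m, d))%N.
have Sb k k' : (k < k')%N -> (S k + b k < S k')%N.
  elim: k' => // k' IH; rewrite ltnS leq_eqVlt /S big_ord_recr /=.
  move=> /predU1P[->|/IH lt]; first by rewrite -addnS.
  by rewrite (leq_trans lt) // leq_addr.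
have bP k m d : size d = L m -> (m <= k)%N -> all (geq k) d ->
    (pickle (m, d) <= b k)%N.
  move=> dL; rewrite -ltnS => mk dk.
  have szd : size (map (inord : nat -> 'I_k.+1) d) == L m.
    by rewrite size_map dL.
  have {1}-> : d = map val (Tuple szd).
    rewrite /= -map_comp -[LHS]map_id; apply/eq_in_map => i /(allP dk) ik.
    by rewrite /= inordK.
  apply: (@leq_trans _ _ _ _ (leq_bigmax (Ordinal mk))).
  exact: (leq_bigmax (Tuple szd)).
have lt m d m' d' : size d = L m -> (K m d < K m' d')%N ->
    (code m d < code m' d')%N.
  move=> dL /Sb lt; rewrite /code (leq_ltn_trans _ (leq_trans lt _)) //.
    by rewrite leq_add2l; have [] := Kbound m d; exact: bP.
  exact: leq_addr.
exists code; split=> // m d m' d' dL d'L e.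
have [KK|KK|KK] := ltngtP (K m d) (K m' d').
- by have := lt _ _ _ _ dL KK; rewrite e ltnn.
- by have := lt _ _ _ _ d'L KK; rewrite e ltnn.
move: e; rewrite /code KK => /addnI /(pcan_inj pickleK) => -[-> ->] //.
Qed.

Definition tail (u : nat -> nat) : nat -> nat := fun n => u n.+1.

Lemma iter_tail (n : nat) (u : nat -> nat) i : iter n tail u i = u (n + i)%N.
Proof. by elim: n i => //= n IH i; rewrite /tail IH addSnnS. Qed.

Definition prepend (s : seq nat) (u : nat -> nat) : nat -> nat :=
  fun n => if (n < size s)%N then nth 0%N s n else u (n - size s)%N.

Lemma prepend_rcons (s : seq nat) (u : nat -> nat) :
  prepend (rcons s (u 0%N)) (tail u) = prepend s u.
Proof.
apply/funext => n; rewrite /prepend size_rcons ltnS nth_rcons.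
case: ltngtP => [ns|ns|->]; last by rewrite subnn.
  by [].
by rewrite /tail -subSn.
Qed.

(* The increasing enumerations of the subsets of [0, m). *)
Fixpoint subsets (m : nat) : seq (seq nat) :=
  if m is k.+1 then subsets k ++ [seq rcons s k | s <- subsets k]
  else [:: [::]].

Lemma nil_subsets (m : nat) : [::] \in subsets m.
Proof. by elim: m => //= m IH; rewrite mem_cat IH. Qed.

Lemma rcons_subsets (m n : nat) (s : seq nat) :
  s \in subsets m -> (m < n)%N -> rcons s m \in subsets n.
Proof.
move=> sm; elim: n => // n IH; rewrite ltnS leq_eqVlt /= mem_cat.
case/predU1P => [<-|/IH->//]; apply/orP; right.
exact: (map_f (rcons^~ m)).
Qed.

(** Prefixes and digit positions recorded at a tail with minimum [m]. As the minima of successive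
    tails are unbounded, every digit is recorded eventually. *)
Definition history (m : nat) : seq (seq nat * nat) :=
  [seq (s, i) | s <- subsets m, i <- iota 0 m.+1].

Lemma historyP (m i : nat) (s : seq nat) :
  ((s, i) \in history m) = (s \in subsets m) && (i <= m)%N.
Proof.
rewrite /history; apply/allpairsP/andP => [[[s' i'] [sm im [-> ->]]]|[sm im]].
  by move: sm im; rewrite mem_iota.
by exists (s, i); rewrite mem_iota.
Qed.

Lemma borel_coord (n : nat) : borel_fun (fun x : infN => enum_of x n).
Proof.
apply: borel_fun_fiber => t; apply: sub_sigma_algebra.
rewrite openE => x /= <-; exact: coord_nbhs.
Qed.

(** A witness of [A] reads membership of [f x] off the coordinates of [f x], which form a Borel
    family. *)
Lemma borel_map_coord (f : infN -> infN) :
  (forall n, borel_fun (fun x => enum_of (f x) n)) -> borel_map f.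
Proof.
move=> fb A /borel_witness[w [_ wb wA]].
rewrite (_ : _ @^-1` _ =
    (fun x => w (enum_of (f x)) 0%N) @^-1` [set m | m != 0%N]).
  by apply: wb.
by apply/seteqP; split=> x /wA.
Qed.

Definition record (w : (nat -> nat) -> nat -> nat) (u : nat -> nat) : seq nat :=
  [seq w (prepend p.1 u) p.2 | p <- history (u 0%N)].

(* Appending [u 0] to the prefix embeds the history of [u] into that of
   [tail u]; this monotonicity is what makes an increasing code possible. *)
Lemma exists_code (w : (nat -> nat) -> nat -> nat) :
  exists code : nat -> seq nat -> nat,
    (forall u u', code (u 0%N) (record w u) = code (u' 0%N) (record w u') ->
       u 0%N = u' 0%N /\ record w u = record w u') /\
    (forall u, (u 0 < u 1)%N ->
       (code (u 0) (record w u) < code (u 1) (record w (tail u)))%N).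
Proof.
(* Strict growth comes from [m]; the maximum need only grow weakly. *)
pose K m (d : seq nat) := (m + \max_(e <- d) e)%N.
have [|code [inj lt]] := @monotone_code K (fun m => size (history m)).
  move=> m d; split; first exact: leq_addr.
  apply/allP => e ed /=.
  by rewrite /K (leq_trans _ (leq_addl _ _)) // leq_bigmax_seq.
exists code; split=> [u u'|u u01]; first by apply: inj; rewrite size_map.
apply: lt; first by rewrite size_map.
rewrite /K -addSn leq_add //; apply/bigmax_leqP_seq => e /mapP[[s i] + ->] _ /=.
rewrite historyP => /andP[su iu]; rewrite -prepend_rcons.
apply: leq_bigmax_seq => //; apply/mapP; exists (rcons s (u 0%N), i) => //.
by rewrite historyP rcons_subsets //= (leq_trans iu) // ltnW.
Qed.

Section Recoding.
Variables (w : (nat -> nat) -> nat -> nat) (code : nat -> seq nat -> nat).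
Let h u := code (u 0%N) (record w u).
Hypothesis hinj : forall u u', h u = h u' ->
  u 0%N = u' 0%N /\ record w u = record w u'.
Hypothesis hlt : forall u, (u 0 < u 1)%N -> (h u < h (tail u))%N.

Lemma recode_increasing (x : infN) :
  (fun n => h (iter n tail (enum_of x))) \in increasing.
Proof.
by apply/mem_set => n; apply: hlt; rewrite !iter_tail addn0 addn1 enum_of_lt.
Qed.

Definition recode (x : infN) : infN := SigSub (recode_increasing x).

Lemma recode_shift (x : infN) : recode (shift x) = shift (recode x).
Proof. by apply/val_inj/funext => n; rewrite /= -iterSr. Qed.

Lemma exists_decode : exists dec : nat -> nat, forall u, dec (h u) = u 0%N.
Proof.
suff /choice[dec decP] : forall c, exists m, forall u, h u = c -> u 0%N = m.
  by exists dec => u; rewrite -(decP (h u) u).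
move=> c; have [[u uc]|nex] := pselect (exists u, h u = c).
  by exists (u 0%N) => u' u'c; have [] := hinj (etrans u'c (esym uc)).
by exists 0%N => u uc; case: nex; exists u.
Qed.

(* Moving [u 0] from [u] to the prefix [s] reduces to the case [n = 0]. *)
Lemma record_digit (n i : nat) (s : seq nat) (u u' : nat -> nat) :
  (forall m, (u m < u m.+1)%N) -> agree n u u' ->
  h (iter n tail u) = h (iter n tail u') ->
  s \in subsets (u 0%N) -> (i <= u n)%N ->
  w (prepend s u) i = w (prepend s u') i.
Proof.
elim: n s u u' => [|n IH] s u u' uinc uu' huu' su iu.
  have [/= u0] := hinj huu'; rewrite /record /= -u0 => /eq_in_map /(_ (s, i)).
  by apply; rewrite historyP su.
rewrite -[LHS](congr1 (w^~ i) (prepend_rcons s u)).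
rewrite -(prepend_rcons s u') -(uu' 0%N) //; apply: IH => //.
- by move=> m; exact: uinc.
- by move=> m mn; exact: uu'.
- by rewrite -!iterSr.
- exact: rcons_subsets.
Qed.

Hypothesis wclosed : closed_graph w.

(** Points [b n] whose recodings tend to [y] converge to some [u], as codes disclose minima. Codes
    also make the digits of [w] at all completions stabilise, and the closed graph identifies the
    limits with the digits at [u]. *)
Lemma closed_recode_image :
  closed (recode @` [set x | w (enum_of x) 0%N != 0%N]).
Proof.
move=> y ycl.
have /choice[b bP] n : exists x, w (enum_of x) 0%N != 0%N /\
    agree n (enum_of (recode x)) (enum_of y).
  by have [_ [[x wx <-] xy]] := ycl _ (cylinder_nbhs y n); exists x.
have hb n k : (k < n)%N -> h (iter k tail (enum_of (b n))) = enum_of y k.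
  by have [_ bn] := bP n; exact: bn.
have b_agree n n' k : (k <= n)%N -> (k <= n')%N ->
    agree k (enum_of (b n)) (enum_of (b n')).
  move=> kn kn' i ik.
  have [|+ _] := hinj (u := iter i tail (enum_of (b n)))
    (u' := iter i tail (enum_of (b n'))).
    by rewrite !hb // (leq_trans ik).
  by rewrite !iter_tail !addn0.
pose u n := enum_of (b n.+1) n.
have u_agree n k : (k <= n)%N -> agree k (enum_of (b n)) u.
  by move=> kn i ik; apply: (@b_agree _ _ i.+1) => //; exact: leq_trans kn.
have uinc : u \in increasing.
  apply/mem_set => n; rewrite -(u_agree n.+2 n.+2) // -(u_agree n.+2 n.+2) //.
  exact: enum_of_lt.
pose x : infN := SigSub uinc.
have digit k s i n : s \in subsets (u k) -> (k + i < n)%N ->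
    w (prepend s (iter k tail u)) i =
    w (prepend s (iter k tail (enum_of (b n)))) i.
  move=> su.
  (* Digit [i] is recorded at the tail of index [k + i], whose minimum is at least [i]; so it is
     common to all [b n] with [k + i < n], where [y] prescribes that code. *)
  pose v i := w (prepend s (iter k tail (enum_of (b (k + i).+1)))) i.
  have vE i' n' : (k + i' < n')%N ->
      w (prepend s (iter k tail (enum_of (b n')))) i' = v i'.
    move=> lt; rewrite /v; apply: (@record_digit i').
    - by move=> m; rewrite !iter_tail addnS enum_of_lt.
    - move=> j ji; rewrite !iter_tail.
      by apply: (@b_agree _ _ (k + i')%N);
        [exact: ltnW | exact: leqnSn | rewrite ltn_add2l].
    - by rewrite -!iterD addnC !hb.
    - rewrite iter_tail addn0 (u_agree n' k.+1) //.
      by rewrite (leq_ltn_trans _ lt) // leq_addr.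
    - rewrite iter_tail.
      have ge m : (m <= enum_of (b n') m)%N.
        by elim: m => // m IH; exact: leq_ltn_trans (enum_of_lt _ _).
      exact: leq_trans (leq_addl _ _) (ge _).
  move=> lt; rewrite (vE _ _ lt).
  rewrite (wclosed (v := v)) // => m.
  pose N := (k + size s + m)%N.
  exists (prepend s (iter k tail (enum_of (b N)))).
    move=> j jm; rewrite /prepend; case: ltnP => // sj.
    rewrite !iter_tail (u_agree N N) // /N -addnA ltn_add2l.
    by rewrite (leq_ltn_trans (leq_subr _ _)) // (leq_trans jm) // leq_addl.
  move=> j jm; apply: vE; rewrite /N -addnA ltn_add2l (leq_trans jm) //.
  exact: leq_addl.
have hu k : h (iter k tail u) = enum_of y k.
  (* The record at this tail involves digits up to [u k] only, all stable at this index. *)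
  pose n := (k + u k).+1.
  rewrite -(hb n k) ?ltnS ?leq_addr //.
  rewrite /h /record !iter_tail addn0 (u_agree n k.+1) ?ltnS ?leq_addr //.
  congr code; apply/eq_in_map => -[s i]; rewrite historyP => /andP[su iu] /=.
  by apply: digit; rewrite // ltnS leq_add2l.
exists x; last by apply/val_inj/funext => n; exact: hu.
(* Membership is digit 0 for the empty prefix, already stable at [b 1]. *)
have [b1 _] := bP 1%N; move: b1; rewrite /mkset.
have := digit 0%N [::] 0%N 1%N (nil_subsets _) isT.
have -> : prepend [::] = id.
  by apply/funext => v; apply/funext => i; rewrite /prepend subn0.
by move=> /= ->.
Qed.

Hypothesis wborel : borel_operator w.

Lemma borel_recode : borel_map recode.
Proof.
apply: borel_map_coord => n.
have -> : (fun x => enum_of (recode x) n) = fun x =>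
    code (enum_of x n) [seq w (prepend p.1 (iter n tail (enum_of x))) p.2
                       | p <- history (enum_of x n)].
  apply/funext => x; rewrite -[LHS]/(h (iter n tail (enum_of x))).
  by rewrite /h /record iter_tail addn0.
(* The list of recorded positions varies with [x], but is constant once [enum_of x n] is fixed. *)
apply: (borel_fun_bind (g := fun m x => code m
  [seq w (prepend p.1 (iter n tail (enum_of x))) p.2 | p <- history m])).
  exact: borel_coord.
move=> m; apply: (borel_fun_comp (code m)); apply: borel_fun_map => -[s i].
apply: wborel => j; rewrite /prepend; case: ltnP => _.
  exact: borel_fun_cst.
rewrite (_ : (fun _ => _) = fun x => enum_of x (n + (j - size s))%N).
  exact: borel_coord.
by apply/funext => x; rewrite iter_tail.
Qed.

End Recoding.

Lemma exists_shift_recoding (B : set infN) : borel B ->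
  exists Phi Psi : infN -> infN,
    [/\ cancel Phi Psi, continuous Psi, borel_map Phi,
        forall x, Phi (shift x) = shift (Phi x) & closed (Phi @` B)].
Proof.
move=> /borel_witness[w [wc wb wB]]; have [code [hinj hlt]] := exists_code w.
have [dec decP] := exists_decode hinj.
(* The maximum makes the result increasing for every [u]; on recodings it changes nothing. *)
pose read (u : nat -> nat) := fix r n :=
  if n is k.+1 then maxn (r k).+1 (dec (u k.+1)) else dec (u 0%N).
have readP y : read (enum_of y) \in increasing.
  by apply/mem_set => n /=; rewrite leq_max leqnn.
have read_agree n u v : agree n u v -> agree n (read u) (read v).
  move=> uv; elim=> [|i IH] ilt /=; first by rewrite uv.
  by rewrite [read u i]IH ?uv // ltnW.
exists (recode hlt), (fun y => SigSub (readP y)); split.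
- move=> x; apply/val_inj/funext; elim=> [|n IH] /=; first exact: decP.
  rewrite [read _ n]IH [dec _](decP (iter n.+1 tail (enum_of x))).
  rewrite iter_tail addn0; apply/maxn_idPr; exact: enum_of_lt.
- move=> y A /nbhs_cylinder[n nA]; apply: filterS (cylinder_nbhs y n) => z zy.
  by apply: nA; exact: read_agree.
- exact: borel_recode.
- exact: recode_shift.
- rewrite (_ : B = [set x | w (enum_of x) 0%N != 0%N]).
    exact: closed_recode_image.
  by apply/seteqP; split=> x /wB.
Qed.

(** * Chromatic numbers *)

Section ChromaticNumber.
Local Open Scope card_scope.
Variables (R : realType) (X X' : topologicalType) (x0 : X').
Variables (E : X -> X -> Prop) (E' : X' -> X' -> Prop) (f : X -> X').
Variable g : X' -> X.
Hypotheses (gf : cancel g f) (fb : borel_map f) (gb : borel_map g).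
Hypotheses (fE : forall x y, E x y -> E' (f x) (f y))
  (gE : forall x y, E' x y -> E (g x) (g y)).

Lemma borel_colorable_pullback (S : set nat) :
  borel_colorable R E' S -> borel_colorable R E S.
Proof.
move=> [Y [c [polishY cb cS cE]]]; exists Y, (c \o f); split=> //.
- by move=> A /cb /fb.
- rewrite (_ : range (c \o f) = range c) //; apply/seteqP; split=> _ [x _ <-].
    by exists (f x).
  by exists (g x) => //=; rewrite gf.
- by move=> x y /fE; exact: cE.
Qed.

(* The range may shrink along [g], which need not be surjective. *)
Lemma borel_colorable_pushforward (S : set nat) :
  borel_colorable R E S -> exists2 S' : set nat,
    borel_colorable R E' S' & S' #<= S /\
      (S' = [set: nat] \/ exists2 m, (0 < m)%N & S' = `I_m).
Proof.
move=> [Y [c [polishY cb cS cE]]].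
have col S' : range (c \o g) #= S' -> borel_colorable R E' S'.
  move=> cgS; exists Y, (c \o g); split=> //.
    by move=> A /cb /gb.
  by move=> x y /gE; exact: cE.
have leS : range (c \o g) #<= S.
  rewrite -(card_le_eqr cS); apply: subset_card_le => _ [x _ <-].
  by exists (g x).
have [/finite_setP[m cm]|inf] := pselect (finite_set (range (c \o g))).
  exists `I_m; first exact: col.
  split; first by rewrite -(card_le_eql cm).
  right; exists m => //; rewrite lt0n; apply/eqP => m0.
  move: cm; rewrite m0 II0 card_eq0 => /eqP/seteqP[+ _] => /(_ (c (g x0))).
  by apply; exists x0.
have cgT : range (c \o g) #= [set: nat].
  rewrite card_eq_le; apply/andP; split; last by apply/infiniteP.
  apply: (card_le_trans leS); exact: subset_card_le.
exists [set: nat]; first exact: col.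
by split; [rewrite -(card_le_eql cgT)|left].
Qed.

(** Pulling back along the surjection [f] keeps the number of colours, and pushing along [g] does
    not raise it, so the minima agree. In the infinite case, a smaller image would be finite,
    against the failure of finite colourings. *)
Lemma eq_borel_chi : borel_chi R E = borel_chi R E'.
Proof.
have pushI n : (0 < n)%N && `[< borel_colorable R E `I_n >] ->
    exists2 m, (m <= n)%N & (0 < m)%N && `[< borel_colorable R E' `I_m >].
  case/andP => n0 /asboolP /borel_colorable_pushforward[S' colS [le]].
  case=> [S'T|[m m0 S'm]].
    by move: le; rewrite S'T; have /finite_setPn := finite_II n.
  exists m; first by move: le; rewrite S'm card_le_II.
  by rewrite m0; apply/asboolP; rewrite -S'm.
have pullI n : (0 < n)%N && `[< borel_colorable R E' `I_n >] ->
    (0 < n)%N && `[< borel_colorable R E `I_n >].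
  move=> /andP[-> /asboolP ?]; apply/asboolP.
  exact: borel_colorable_pullback.
rewrite /borel_chi; case: pselect => [ex|nex]; case: pselect => [ex'|nex'].
- congr Defs.Finite; case: ex_minnP => m Pm minm.
  case: ex_minnP => m' Pm' minm'.
  apply/eqP; rewrite eqn_leq minm ?pullI //=.
  by have [k km /minm' /leq_trans] := pushI _ Pm; apply.
- by exfalso; case: ex => n /pushI[m _ Pm]; case: nex'; exists m.
- by exfalso; case: ex' => n /pullI Pn; case: nex; exists n.
- congr (if _ then _ else _); apply/asbool_equiv_eq; split.
    case/borel_colorable_pushforward => S' colS [_ [<-//|[m m0 S'm]]].
    by case: nex'; exists m; rewrite m0; apply/asboolP; rewrite -S'm.
  exact: borel_colorable_pullback.
Qed.

End ChromaticNumber.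

Theorem theorem1p4 (R : realType) (B : set infN) (hB : borel B) :
  (exists (C : set infN) (Psi : infN -> infN),
      [/\ closed C, shift_embedding C B Psi &
        borel_chi R (graph_restr shift_graph C) =
        borel_chi R (graph_restr shift_graph B)]) /\
  (shift_closed B ->
    exists (C : set infN) (Psi : infN -> infN),
      [/\ closed C, shift_embedding C B Psi, set_bij C B Psi &
        borel_chi R (graph_restr shift_graph C) =
        borel_chi R (graph_restr shift_graph B)]).
Proof.
suff [C [Psi [clC emb bij chi]]] : exists (C : set infN) (Psi : infN -> infN),
    [/\ closed C, shift_embedding C B Psi, set_bij C B Psi &
      borel_chi R (graph_restr shift_graph C) =
      borel_chi R (graph_restr shift_graph B)].
  by split=> [|_]; exists C, Psi.
have [Phi [Psi [PhiK Psic Phib PhiS clC]]] := exists_shift_recoding hB.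
exists (Phi @` B), Psi.
have fun_Psi : set_fun (Phi @` B) B Psi by move=> _ [x Bx <-]; rewrite PhiK.
have inj_Psi : set_inj (Phi @` B) Psi.
  by move=> _ _ /set_mem[x _ <-] /set_mem[y _ <-]; rewrite !PhiK => ->.
have PsiS y : (Phi @` B) y -> Psi (shift y) = shift (Psi y).
  by move=> [x _ <-]; rewrite -PhiS !PhiK.
split=> //.
- split=> //.
  + exact: continuous_subspaceT.
  + by move=> y Cy _; exact: PsiS.
  + have pinvE x : B x -> 'pinv_(id) (Phi @` B) Psi x = Phi x.
      move=> Bx; rewrite -{1}(PhiK x).
      by apply: pinvKV; [exact: inj_Psi | apply/mem_set; exists x].
    have imB x : (Psi @` (Phi @` B)) x -> B x.
      by case=> _ [z Bz <-] <-; rewrite PhiK.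
    by move=> x /imB Bx /imB BSx; rewrite !pinvE.
- split=> // x Bx; exists (Phi x) => //; by exists x.
- pose x0 : infN := SigSub (mem_set (@ltnSn : increasing id)).
  apply: (eq_borel_chi R x0 (f := Psi) (g := Phi)) => //.
  + apply: borel_map_open => U oU; apply: sub_sigma_algebra.
    by apply: open_comp => // y _; exact: Psic.
  + move=> y y' [[ne adj] [x Bx xy] [x' Bx' xy']].
    move: ne adj; rewrite -xy -xy' => ne adj; split; rewrite ?PhiK //.
    split=> [xx'|]; first by apply: ne; rewrite xx'.
    by case: adj => /(congr1 Psi); rewrite -PhiS !PhiK; [left|right].
  + move=> x y [[ne adj] Bx By]; split; [|by exists x|by exists y].
    split=> [/(can_inj PhiK)//|].
    by case: adj => <-; rewrite -PhiS; [left|right].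
Qed.
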